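(* Let $G$ be a finite group with an abelian subgroup $H$ of index $2$. Suppose that $X=\mathrm{Cay}(G,S)$, where $S\subseteq G\setminus\{1_G\}$ is inverse-closed, admits perfect state transfer, and let $T$ be its PST involution. If $T=L_s$ for some $s\in G\setminus H$, then $\langle R(H),L_s\rangle\le\mathrm{Aut}(X)$ is an abelian regular subgroup of order $|G|$. In particular, $X$ is a Cayley graph of the abelian group $H\times C_2$.
   Context: $\mathrm{Cay}(G,S)$ is the graph with vertex set $G$ in which $g\sim h$ if and only if $hg^{-1}\in S$. A graph $X$ is a Cayley graph of a group $K$ if $X\cong\mathrm{Cay}(K,S')$ for some inverse-closed $S'\subseteq K\setminus\{1_K\}$. For $a\in G$, $R_a$ and $L_a$ denote the permutations $x\mapsto xa$ and $x\mapsto ax$ of $G$; $R(H)=\{R_h:h\in H\}$. A permutation group is regular if it is transitive with trivial point stabilizers. $C_2$ is the cyclic group of order two. For a graph $X$ with adjacency matrix $A$, put $U(t)=\exp(itA)$. $X$ admits perfect state transfer (PST) at time $\tau$ if $|U(\tau)_{v,u}|=1$ for some distinct vertices $u,v$. For a vertex-transitive graph $X$ with PST at time $\tau$, it is known that $U(\tau)$ is a scalar multiple of a permutation matrix $T$ of order two without fixed points which lies in the centre of $\mathrm{Aut}(X)$; $T$, regarded as a permutation of $V(X)$, is called the PST involution of $X$. *)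

(* Defs.v *)
From HB Require Import structures.
From mathcomp Require Import all_boot all_order all_algebra all_fingroup.
From mathcomp Require Import all_classical all_reals all_analysis.
From mathcomp Require Import complex.

Set Implicit Arguments.
Unset Strict Implicit.
Unset Printing Implicit Defensive.

Import Order.TTheory GRing.Theory Num.Theory.
Import numFieldNormedType.Exports.

Local Open Scope ring_scope.

(* A graph on V is given by its adjacency relation, a [rel V]. *)

Definition Cay (gT : finGroupType) (S : {set gT}) : rel gT :=
  fun g h => (h * g^-1)%g \in S.

Definition inverse_closed (gT : finGroupType) (S : {set gT}) : Prop :=
  {in S, forall x, (x^-1)%g \in S}.

Definition graph_iso (V W : finType) (e : rel V) (f : rel W) : Prop :=
  exists2 phi : V -> W, bijective phi & forall x y, f (phi x) (phi y) = e x y.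

Definition is_Cayley_graph_of (V : finType) (e : rel V) (K : finGroupType) :
    Prop :=
  exists S : {set K},
    [/\ 1%g \notin S, inverse_closed S & graph_iso e (Cay S)].

Definition graph_aut (V : finType) (e : rel V) : {set {perm V}} :=
  [set p : {perm V} | [forall x, forall y, e (p x) (p y) == e x y]].

Lemma graph_aut_group_set (V : finType) (e : rel V) : group_set (graph_aut e).
Proof.
apply/group_setP; split.
  by rewrite inE; apply/forallP=> x; apply/forallP=> y; rewrite !perm1.
move=> p q; rewrite !inE => /forallP hp /forallP hq.
apply/forallP=> x; apply/forallP=> y; rewrite !permM.
by rewrite (eqP (forallP (hq (p x)) (p y))) (forallP (hp x) y).
Qed.

Canonical graph_aut_group (V : finType) (e : rel V) :=
  Group (graph_aut_group_set e).

Definition regular_perm_group (V : finType) (K : {group {perm V}}) : Prop :=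
  [transitive K, on [set: V] | 'P] /\ forall x : V, 'C_K[x | 'P]%g = 1%g.

Definition Rmul (gT : finGroupType) (a : gT) : {perm gT} := perm (@mulIg _ a).

Definition Lmul (gT : finGroupType) (a : gT) : {perm gT} := perm (@mulgI _ a).

(* The limit is taken in the (entrywise) topology of matrices over C. *)
Definition expmx (C : numFieldType) (n : nat) (B : 'M[C]_n) : 'M[C]_n :=
  limn (series (fun k : nat => (k`!%:R)^-1 *: B ^+ k)).

(* Matrices whose rows and columns are indexed by a finite type V have size
   #|V|, the entry at (x, y) being the one at (enum_rank x, enum_rank y). *)

Definition adjmx (C : numFieldType) (V : finType) (e : rel V) : 'M[C]_#|V| :=
  \matrix_(i, j) (e (enum_val i) (enum_val j))%:R.

Definition vperm_mx (C : numFieldType) (V : finType) (T : {perm V}) :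
    'M[C]_#|V| :=
  \matrix_(i, j) (T (enum_val i) == enum_val j)%:R.

Definition transition_mx (R : realType) (V : finType) (e : rel V) (t : R) :
    'M[(R[i]%C : numFieldType)]_#|V| :=
  expmx (('i%C * t%:C%C) *: adjmx (R[i]%C : numFieldType) e).

Definition PST_at (R : realType) (V : finType) (e : rel V) (tau : R) : Prop :=
  exists u v : V, u != v /\
    `|transition_mx e tau (enum_rank v) (enum_rank u)| = 1.

Definition admits_PST (R : realType) (V : finType) (e : rel V) : Prop :=
  exists tau : R, PST_at e tau.

(* The further properties of T (order two, no fixed points, central in the
   automorphism group) are consequences for a vertex-transitive graph and are
   not part of the definition.  As T has order two, its permutation matrix is
   symmetric, so the row/column convention in [vperm_mx] is immaterial. *)
Definition is_PST_involution (R : realType) (V : finType) (e : rel V)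
    (T : {perm V}) : Prop :=
  exists tau : R, PST_at e tau /\
    exists gamma : R[i]%C, transition_mx e tau = gamma *: vperm_mx _ T.

(* Main.v *)
(* U(tau) is a limit of polynomials in the symmetric matrix A, so it is symmetric
   and commutes with A.  As U(tau) is a nonzero multiple of the permutation
   matrix of T, the permutation T is an involution and an automorphism of X.
   For T = L_s this says that s^2 = 1 and that S is stable under conjugation by
   s.  Left and right multiplications commute, so <R(H), L_s> is abelian; it is
   transitive because G is the union of H and sH, hence regular.  The
   isomorphism with a Cayley graph of H x C_2 sends s^a h to (h, a). *)

Require Import Defs.
From mathcomp Require Import all_boot all_order all_algebra all_fingroup.
From mathcomp Require Import all_classical all_reals all_analysis.
From mathcomp Require Import complex.

Set Implicit Arguments.
Unset Strict Implicit.
Unset Printing Implicit Defensive.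

Import GRing.Theory Num.Theory.
Import numFieldNormedType.Exports.

(** * Matrix exponentials and PST involutions *)

Section MatrixExponential.
Local Open Scope ring_scope.

(* If the series diverges then [limn] returns the default matrix, which is 0,
   so convergence need not be established. *)
Lemma expmx_linear0 (C : numFieldType) n (B : 'M[C]_n)
    (f : {linear 'M[C]_n -> 'M[C]_n}) :
  (forall k, f (B ^+ k) = 0) -> f (expmx B) = 0.
Proof.
move=> fB0; rewrite /expmx; set u := series _.
have [cvu|/dvgP ->] := pselect (cvgn u); last first.
  suff -> : point = 0 :> 'M[C]_n by rewrite linear0.
  by apply/matrixP => i j; rewrite !mxE.
have fu0 m : f (u m) = 0.
  rewrite /u /series/= linear_sum big1 // => k _.
  by rewrite linearZ/= fB0 scaler0.
(* Expanding [M] in matrix units makes each entry of [f M] a finite combination of entries of [M],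
   so [f] passes to the limit. *)
have fE (M : 'M[C]_n) p q :
    f M p q = \sum_i \sum_j M i j * f (delta_mx i j) p q.
  rewrite {1}(matrix_sum_delta M) linear_sum summxE; apply: eq_bigr => i _.
  rewrite linear_sum summxE; apply: eq_bigr => j _.
  by rewrite linearZ mxE.
apply/matrixP => p q; rewrite [RHS]mxE.
have fu_cvg : (f (u m) p q @[m --> \oo] --> f (limn u) p q)%classic.
  rewrite fE; under eq_cvg do rewrite fE.
  apply: cvg_big => [|i _]; first exact: add_continuous.
  apply: cvg_big => [|j _]; first exact: add_continuous.
  apply: cvgMr_tmp.
  exact: (continuous_cvg _ (@coord_continuous C n n i j (limn u)) cvu).
rewrite -(cvg_lim (@norm_hausdorff _ _) fu_cvg).
under eq_fun do rewrite fu0 mxE.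
exact: lim_cst.
Qed.

(** The linear map sending [X] to [A *m X - X *m A] vanishes on every power of [B]. *)
Lemma mulmx_expmxC (C : numFieldType) n (A B : 'M[C]_n) :
  A *m B = B *m A -> A *m expmx B = expmx B *m A.
Proof.
move=> AB; pose f := (mulmx A \- mulmxr A) : {linear 'M[C]_n -> 'M[C]_n}.
apply/eqP; rewrite -subr_eq0; apply/eqP.
apply: (@expmx_linear0 C n B f) => k /=; apply/eqP; rewrite subr_eq0.
exact/eqP/(commrX k (AB : GRing.comm A B)).
Qed.

Lemma trmx_expmx (C : numFieldType) n (B : 'M[C]_n) :
  B^T = B -> (expmx B)^T = expmx B.
Proof.
move=> symB; pose f := (trmx \- idfun) : {linear 'M[C]_n -> 'M[C]_n}.
apply/eqP; rewrite -subr_eq0; apply/eqP.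
apply: (@expmx_linear0 C n B f) => k /=; apply/eqP; rewrite subr_eq0.
elim: k => [|k /eqP IHk]; first by rewrite !expr0 trmx1.
by apply/eqP; rewrite [in LHS]exprSr trmx_mul symB IHk [RHS]exprS.
Qed.

Lemma adjmx_comm_aut (C : numFieldType) (V : finType) (e : rel V)
    (T : {perm V}) :
  vperm_mx C T *m adjmx C e = adjmx C e *m vperm_mx C T -> T \in graph_aut e.
Proof.
move=> TA; rewrite inE; apply/forallP => x; apply/forallP => y.
(* At the entry [(x, T y)] each product has a single surviving term: [e (T x) (T y)] on the left,
   [e x y] on the right. *)
have := congr1 (fun M : 'M[C]_#|V| => M (enum_rank x) (enum_rank (T y))) TA.
rewrite /= !mxE (bigD1 (enum_rank (T x))) //= big1 ?addr0; last first.
  move=> i ix; rewrite !mxE enum_rankK; case: eqP => [Tx|]; last by rewrite mul0r.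
  by rewrite Tx enum_valK eqxx in ix.
rewrite (bigD1 (enum_rank y)) //= big1 ?addr0; last first.
  move=> i iy; rewrite !mxE !enum_rankK (inj_eq perm_inj).
  case: eqP => [yi|]; last by rewrite mulr0.
  by rewrite -yi enum_valK eqxx in iy.
rewrite !mxE !enum_rankK !eqxx mul1r mulr1 => /eqP.
by rewrite eqr_nat; case: (e _ _); case: (e _ _).
Qed.

Lemma vperm_mx_sym (C : numFieldType) (V : finType) (T : {perm V}) :
  (vperm_mx C T)^T = vperm_mx C T -> involutive T.
Proof.
move=> symT x.
have := congr1 (fun M : 'M[C]_#|V| => M (enum_rank x) (enum_rank (T x))) symT.
rewrite /= !mxE !enum_rankK eqxx => /eqP.
by rewrite eqr_nat eqb1 => /eqP.
Qed.

End MatrixExponential.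

Section PSTInvolution.
Local Open Scope ring_scope.
Variables (R : realType) (V : finType) (e : rel V) (T : {perm V}).
Hypothesis PST_T : is_PST_involution R e T.

(** Since PST provides an entry of modulus 1, the scalar cannot vanish; it can then be cancelled in
    matrix identities. *)
Lemma PST_involutionE : exists tau : R, exists2 gamma : R[i]%C,
  gamma != 0 & transition_mx e tau = (gamma *: vperm_mx _ T).
Proof.
have [tau [[u [v [_ Uuv]]] [gamma UT]]] := PST_T.
exists tau; exists gamma => //; apply: contra_eq_neq Uuv => gamma0.
by rewrite UT gamma0 scale0r mxE normr0 eq_sym oner_neq0.
Qed.

Lemma PST_involution_aut : T \in graph_aut e.
Proof.
have [tau [gamma gamma0 UT]] := PST_involutionE.
apply: (@adjmx_comm_aut (R[i]%C : numFieldType)).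
apply: (scalerI gamma0); rewrite scalemxAl scalemxAr -UT.
by rewrite /transition_mx -mulmx_expmxC // -scalemxAl -scalemxAr.
Qed.

Lemma PST_involution_involutive : symmetric e -> involutive T.
Proof.
have [tau [gamma gamma0 UT]] := PST_involutionE.
move=> sym_e; apply: (@vperm_mx_sym (R[i]%C : numFieldType)).
apply: (scalerI gamma0); rewrite -linearZ/= -UT trmx_expmx // linearZ/=.
by congr (_ *: _); apply/matrixP => i j; rewrite !mxE sym_e.
Qed.

End PSTInvolution.

(** * Cayley graphs *)

Section CayleyGraphs.
Local Open Scope group_scope.

Lemma Cay_sym (gT : finGroupType) (S : {set gT}) :
  inverse_closed S -> symmetric (Cay S).
Proof.
move=> SV x y; rewrite /Cay; apply/idP/idP => /SV; by rewrite invMg invgK.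
Qed.

Lemma Rmul_aut (gT : finGroupType) (S : {set gT}) a : Rmul a \in graph_aut (Cay S).
Proof.
rewrite inE; apply/forallP => x; apply/forallP => y.
by rewrite /Cay !permE invMg mulgA mulgK.
Qed.

Lemma Lmul_aut_conj (gT : finGroupType) (S : {set gT}) s :
  Lmul s \in graph_aut (Cay S) -> forall x, (s * x * s^-1 \in S) = (x \in S).
Proof.
(* The automorphism is tested on the pair [(1, x)], whose image is [(s, s * x)]. *)
rewrite inE => /forallP /(_ 1) /forallP Ls x.
by have /eqP := Ls x; rewrite /Cay !permE mulg1 invg1 mulg1.
Qed.

(** An element fixing [x] commutes with all of [K], so it fixes the whole orbit of [x]. *)
Lemma abelian_transitive_regular (V : finType) (K : {group {perm V}}) :
  abelian K -> [transitive K, on [set: V] | 'P] -> regular_perm_group K.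
Proof.
move=> /centsP cK trK; split=> // x; apply/trivgP/fintype.subsetP => p.
case/finset.setIP=> [Kp /astab1P px]; rewrite inE; apply/eqP/permP => y.
have [q Kq ->] := atransP2 trK (finset.in_setT x) (finset.in_setT y).
by rewrite perm1 /= /aperm -permM (cK _ Kq _ Kp) permM [p x]px.
Qed.

Lemma card_regular_perm_group (V : finType) (K : {group {perm V}}) (x : V) :
  regular_perm_group K -> #|K| = #|[set: V]|.
Proof.
move=> [trK stK]; rewrite -(atransP trK x (finset.in_setT x)) card_orbit.
by rewrite stK indexg1.
Qed.

(** * Abelian subgroups of index two and an involution outside them *)

Section Index2.
Variables (gT : finGroupType) (H : {group gT}) (s : gT).
Hypotheses (abH : abelian H) (iH : #|[set: gT] : H| = 2%N).
Hypotheses (sH : s \notin H) (ss : s * s = 1).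

Lemma index2_mulV g : g \notin H -> s * g \in H.
Proof.
move=> gH; have sD : s \in [set: gT] :\: H by rewrite !inE sH.
(* The complement of [H] is the single right coset [H :* s], and it contains [g^-1]. *)
have : g^-1 \in H :* s.
  by rewrite (rcoset_index2 (finset.subsetT H) iH sD) !inE groupV gH.
by rewrite mem_rcoset -groupV invMg !invgK.
Qed.

Let K := <<[set Rmul h | h in H] :|: [set Lmul s]>>%G.

Lemma Rmul_Lmul_abelian : abelian K.
Proof.
rewrite abelian_gen; apply/centsP => p + q; rewrite !inE.
case/orP => [/imsetP[a Ha ->]|/eqP ->] /orP[/imsetP[b Hb ->]|/eqP ->] //;
  apply/permP => x; rewrite !permM !permE ?mulgA // -!mulgA.
by rewrite (centsP abH _ Ha _ Hb).
Qed.

Lemma Rmul_Lmul_transitive : [transitive K, on [set: gT] | 'P].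
Proof.
have RK a : a \in H -> Rmul a \in K.
  by move=> Ha; apply: mem_gen; rewrite inE imset_f.
have LK : Lmul s \in K by apply: mem_gen; rewrite !inE eqxx orbT.
apply/imsetP; exists 1; first exact: finset.in_setT.
apply/setP => g; rewrite finset.in_setT; apply/esym/orbitP.
have [gH|gH] := boolP (g \in H).
  by exists (Rmul g); [exact: RK|rewrite /= /aperm permE mul1g].
exists (Rmul (s * g) * Lmul s); first by rewrite groupM // RK ?index2_mulV.
by rewrite /= /aperm permM !permE mul1g mulgA ss mul1g.
Qed.

(** The bijection [psi] need not be a homomorphism, as [s] may fail to commute with [H]; invariance
    of [S] under conjugation by [s] still makes it preserve adjacency, with the preimage of [S] as
    connection set. *)
Lemma Cay_index2_iso (S : {set gT}) :
    (forall x, (s * x * s^-1 \in S) = (x \in S)) ->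
    1 \notin S -> inverse_closed S ->
  is_Cayley_graph_of (Cay S) ([subg H] * 'Z_2)%type.
Proof.
move=> Sconj S1 SV.
pose psi (u : [subg H] * 'Z_2) : gT := s ^+ (u.2 : nat) * sgval u.1.
(* The product in ['Z_2] is addition modulo 2, which the exponents respect because [s * s = 1]. *)
have sD (a b : 'Z_2) : s ^+ (a * b)%g = s ^+ a * s ^+ b.
  by rewrite -expgD; apply: (@expg_mod _ 2 (a + b)%N).
have sI (a : 'Z_2) : s ^+ (a^-1)%g = (s ^+ a)^-1.
  by apply/eqP; rewrite eq_mulgV1 invgK -sD mulVg.
have SconjX n x : (s ^+ n * x * (s ^+ n)^-1 \in S) = (x \in S).
  elim: n => [|n IHn]; first by rewrite !expg0 invg1 mul1g mulg1.
  by rewrite -IHn -[RHS]Sconj expgS invMg !mulgA.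
pose phi g : [subg H] * 'Z_2 :=
  if g \in H then (subg H g, 1) else (subg H (s * g), Ordinal (isT : 1 < 2)).
have psiM u v : (psi (v * u^-1) \in S) = Cay S (psi u) (psi v).
  (* Conjugating [psi (v * u^-1)] by [s ^+ u.2] gives exactly [psi v * (psi u)^-1]. *)
  rewrite /Cay -[LHS](SconjX u.2) /psi.
  have -> : (v * u^-1).2 = (u.2^-1 * v.2)%g by exact: Zp_mulgC.
  by rewrite sD sI invMg !mulgA mulgV mul1g.
exists [set u | psi u \in S]; split.
- by rewrite inE /psi expg0 mul1g.
(* Reading [u^-1] as [1 * u^-1] turns closure under inverses into symmetry of [Cay S]. *)
- by move=> u; rewrite !inE -[u^-1]mul1g psiM Cay_sym // -psiM invg1 mulg1.
have phiK : cancel phi psi.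
  rewrite /phi /psi => g; case: ifPn => gH /=.
    by rewrite expg0 mul1g subgK.
  by rewrite expg1 subgK ?index2_mulV // mulgA ss mul1g.
exists phi => [|x y]; last first.
  by rewrite -[in RHS](phiK x) -[in RHS](phiK y) -psiM /Cay inE.
exists psi => // -[h [[|[|//]] a2]]; rewrite /phi /psi /=.
  by rewrite expg0 mul1g subgP sgvalK; congr (_, _); apply: val_inj.
rewrite expg1 groupMr ?subgP // (negPf sH) mulgA ss mul1g sgvalK.
by congr (_, _); apply: val_inj.
Qed.

End Index2.

End CayleyGraphs.

Theorem lemma5p4 (R : realType) (gT : finGroupType) (H : {group gT})
    (S : {set gT}) (T : {perm gT}) (s : gT) :
  abelian H -> #|[set: gT] : H|%g = 2%N ->
  (1%g : gT) \notin S -> inverse_closed S ->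
  admits_PST R (Cay S) -> is_PST_involution R (Cay S) T ->
  s \notin H -> T = Lmul s ->
  let K := <<[set Rmul h | h in H] :|: [set Lmul s]>>%G in
  [/\ K \subset graph_aut (Cay S),
      abelian K,
      regular_perm_group K,
      #|K| = #|[set: gT]| &
      abelian [set: [subg H] * 'Z_2] /\
      is_Cayley_graph_of (Cay S) ([subg H] * 'Z_2)%type].
Proof.
move=> abH iH S1 SV _ PST_T sH TE K.
have autL : Lmul s \in graph_aut (Cay S) by rewrite -TE (PST_involution_aut PST_T).
have ss : (s * s = 1)%g.
  (* Applying [Lmul s] twice to the identity gives [s * s]. *)
  by have := PST_involution_involutive PST_T (Cay_sym SV) 1%g; rewrite TE !permE mulg1.
have abK : abelian K := Rmul_Lmul_abelian s abH.
have regK : regular_perm_group K.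
  exact: abelian_transitive_regular abK (Rmul_Lmul_transitive iH sH ss).
split=> //.
- rewrite gen_subG finset.subUset finset.sub1set autL andbT.
  by apply/fintype.subsetP => _ /imsetP[h _ ->]; exact: Rmul_aut.
- exact: card_regular_perm_group 1%g regK.
split; last exact: (Cay_index2_iso iH sH ss (Lmul_aut_conj autL)).
apply/centsP => -[h a] _ [k b] _; congr (_, _); last exact: Zp_mulgC.
by apply: val_inj; exact: (centsP abH _ (subgP h) _ (subgP k)).
Qed.
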